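(* Let $k$ be a field of characteristic zero, and let $H: 1, h_1, \ldots, h_e, h_{e+1}=0$ (with $h_i=0$ for $i>e$) be a sequence that occurs as the Hilbert function of some standard graded artinian $k$-algebra. Then all standard graded artinian $k$-algebras having Hilbert function $H$ enjoy the Weak Lefschetz Property if and only if every Gotzmann $k$-algebra having Hilbert function $H$ enjoys the Weak Lefschetz Property.
   Context: A standard graded artinian $k$-algebra is a quotient $A = R/I$ of finite $k$-dimension, where $R = k[x_1,\ldots,x_r]$ is a polynomial ring (for some $r$) with all $x_i$ of degree 1, and $I$ is a homogeneous ideal. Its Hilbert function is $h_i = \dim_k A_i$. $A$ enjoys the Weak Lefschetz Property (WLP) if, for a generic linear form $L \in R$ (i.e. for all $L$ in some nonempty Zariski-open subset of $R_1$) and for all indices $i \geq 0$, the multiplication map $\cdot L : A_i \to A_{i+1}$ has maximal rank, i.e. is injective or surjective. A homogeneous ideal $I \subset R$ is a Gotzmann ideal if, for every degree $d$, one has $\dim_k R_1 I_d = \dim_k R_1 \mathcal{L}_d$, where $\mathcal{L}_d \subset R_d$ is the span of the $\dim_k I_d$ lexicographically largest monomials of degree $d$ (i.e. $R_1 I_d$ has the smallest dimension allowed by Macaulay's theorem). An algebra $R/I$ is called Gotzmann if $I$ is a Gotzmann ideal. *)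

(* Defs.v *)
From Stdlib Require Import ClassicalEpsilon.
From HB Require Import structures.
From mathcomp Require Import all_boot all_order all_algebra.
From mathcomp Require Import ring_quotient.
From mathcomp Require Import mpoly.

Set Implicit Arguments.
Unset Strict Implicit.
Unset Printing Implicit Defensive.

Import Order.TTheory GRing.Theory.
Local Open Scope ring_scope.

Section GradedArtinian.
Variables (k : fieldType) (r : nat).

(* [r.+1] variables: the library makes [dhomog n k d] a vector space only when
   n > 0. *)
Local Notation R := {mpoly k[r.+1]}.
Local Notation R_ d := (dhomog r.+1 k d).

Implicit Types (I : {pred R}) (d i m : nat).

(* [idealr_closed] includes 1 \notin I; a quotient with h_0 = 1 always has a
   proper ideal. *)
Definition homogeneous_ideal I : Prop :=
  idealr_closed I /\ forall f d, f \in I -> pihomog mdeg d f \in I.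

Definition fin_dim_quotient I : Prop :=
  exists s : seq R, forall f : R,
    exists c : nat -> k, f - \sum_(i < size s) c i *: s`_i \in I.

Definition artinian_ideal I : Prop :=
  homogeneous_ideal I /\ fin_dim_quotient I.

(* The subspace I_d of R_d. Membership in I is an arbitrary predicate, so the
   subspace is obtained by description; see [degpartP]. *)
Definition degpart I d : {vspace R_ d} :=
  epsilon (inhabits 0%VS)
    (fun U : {vspace R_ d} => forall f : R_ d, (f \in U) = ((f : R) \in I)).

Definition hilbert I d : nat :=
  (\dim {: R_ d} - \dim (degpart I d))%N.

Definition mul_form d (l : R_ 1) (f : R_ d) : R_ d.+1 :=
  DHomog (dhomogM (dhomog_is_dhomog l) (dhomog_is_dhomog f)).

(* The span R_1 V of all products of a linear form by an element of V. *)
Definition R1mul d (V : {vspace R_ d}) : {vspace R_ d.+1} :=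
  <<[seq mul_form l f | l <- vbasis {: R_ 1}, f <- vbasis V]>>%VS.

(* The order on ['X_{1..n}] compares total degrees first and then exponent
   sequences lexicographically: in a fixed degree it is the lexicographic order
   with the variable of index 0 the largest. *)
Definition lex_monomials d : seq 'X_{1..r.+1} :=
  sort >=%O
    [seq a <- [seq bmnm b | b : 'X_{1..r.+1 < d.+1}] | mdeg a == d].

Definition lexseg d m : {vspace R_ d} :=
  <<[seq indhomog d 'X_[k, a] | a <- take m (lex_monomials d)]>>%VS.

Definition gotzmann I : Prop :=
  forall d, \dim (R1mul (degpart I d))
          = \dim (R1mul (lexseg d (\dim (degpart I d)))).

(* Zariski-open subsets of the affine space R_1, with the coefficients of a
   linear form as its coordinates. *)
Definition zariski_open (U : R_ 1 -> Prop) : Prop :=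
  exists S : R -> Prop, forall L : R_ 1,
    U L <-> exists2 P : R, S P & P.@[fun j => (L : R)@_(U_(j))] != 0.

(* Multiplication by L from A_i to A_{i+1}, where A = R/I; equality in A is
   congruence modulo I. *)
Definition mul_injective I (L : R_ 1) i : Prop :=
  forall f g : R_ i, (L : R) * f - (L : R) * g \in I -> (f : R) - g \in I.

Definition mul_surjective I (L : R_ 1) i : Prop :=
  forall g : R_ i.+1, exists f : R_ i, (L : R) * f - g \in I.

Definition WLP I : Prop :=
  exists U : R_ 1 -> Prop,
    [/\ zariski_open U, exists L, U L
      & forall L, U L -> forall i, mul_injective I L i \/ mul_surjective I L i].

Lemma degpartP I d (f : R_ d) :
  idealr_closed I -> (f \in degpart I d) = ((f : R) \in I).
Proof.
move=> [I0 _ Icl]; move: f; rewrite /degpart.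
apply: (epsilon_spec (inhabits 0%VS)
  (fun U : {vspace R_ d} => forall f : R_ d, (f \in U) = ((f : R) \in I))).
have IZ c f : f \in I -> c *: f \in I.
  by move=> fI; rewrite -mul_mpolyC -[_ * _]addr0 Icl.
have ID f g : f \in I -> g \in I -> f + g \in I.
  by move=> fI gI; rewrite -[f]mul1r Icl.
suff H n (U : {vspace R_ d}) : (\dim {: R_ d} - \dim U <= n)%N ->
    (forall f, f \in U -> (f : R) \in I) ->
    exists U : {vspace R_ d}, forall f : R_ d, (f \in U) = ((f : R) \in I).
  by apply: (H _ 0%VS (leqnn _)) => f; rewrite memv0 => /eqP ->; rewrite linear0.
elim: n U => [|n IHn] U leUn UI.
  exists U => f; apply/idP/idP => [/UI //|_].
  have /eqP -> : U == fullv by rewrite eqEdim subvf -subn_eq0 -leqn0.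
  exact: memvf.
case: (classic (exists2 f : R_ d, (f : R) \in I & f \notin U)) => [[f fI fU]|nex].
  apply: (IHn (U + <[f]>)%VS) => [|_ /memv_addP[u uU [_ /vlineP[c ->] ->]]].
    have ltU : (\dim U < \dim (U + <[f]>))%N.
      rewrite ltn_neqAle dimvS ?addvSl // andbT.
      apply: contra fU => /eqP eqd.
      have /eqP -> : U == (U + <[f]>)%VS by rewrite eqEdim addvSl eqd /=.
      exact: (subvP (addvSr _ _)) (memv_line f).
    have le2 := dimvS (subvf (U + <[f]>)%VS).
    rewrite -ltnS; apply: leq_trans leUn.
    exact: ltn_sub2l (leq_trans ltU le2) ltU.
  by rewrite linearD linearZ /=; apply: ID; [exact: UI | exact: IZ].
exists U => f; apply/idP/idP => [/UI //|fI].
by apply/negPn/negP => fU; apply: nex; exists f.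
Qed.

End GradedArtinian.

(* Main.v *)
Require Import Defs.
From Stdlib Require Import Classical.
From HB Require Import structures.
From mathcomp Require Import all_boot all_order all_algebra.
From mathcomp Require Import ring_quotient.
From mathcomp Require Import mpoly.
From mathcomp Require Import zify.

(* Write [c_<d>] for the number of monomials not divisible by the last variable
   among the [c] lexicographically smallest monomials of degree [d]. Green's
   hyperplane restriction theorem bounds the cokernel of a generic linear form
   on [A_i -> A_(i+1)] by [(h_(i+1))_<i+1>], and with a linear form involving
   the last variable the quotient by a lex-segment ideal attains at least this
   value. Green's theorem also gives Macaulay's growth bound, so that the
   lex-segment ideal with Hilbert function [H] exists; it is a Gotzmann ideal.
   If its quotient has the WLP, then [(h_(i+1))_<i+1>] is at most the truncated
   difference [h_(i+1) - h_i], and Green's theorem forces maximal rank for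
   every algebra with Hilbert function [H]. *)

Set Implicit Arguments.
Unset Strict Implicit.
Unset Printing Implicit Defensive.

Import Order.TTheory GRing.Theory.

(** * Counting in lexicographic segments *)

Section LexCounting.
Implicit Types (s t : seq nat) (b c l n d : nat).

(* A monomial of degree [d.+1] is reached from exactly one monomial of degree
   [d] by multiplying it by a variable that is not larger than any variable in
   its support. List the monomials of degree [d] in [n] variables by increasing
   lexicographic order: [lasts n d] is the list of the numbers of children in
   this tree. For [d > 0] the [i]-th entry is also the rank of the smallest
   variable of the [i]-th monomial, with rank 1 for the last variable, so that
   entries [>= 2] stand for the monomials free of the last variable. *)
Definition children s : seq nat := flatten [seq iota 1 l | l <- s].

Definition lasts n d : seq nat := iter d children [:: n].

Definition lastfree s c : nat := count (leq 2) (take c s).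

Lemma children_cat s t : children (s ++ t) = children s ++ children t.
Proof. by rewrite /children map_cat flatten_cat. Qed.

Lemma children_cons l s : children (l :: s) = iota 1 l ++ children s.
Proof. by []. Qed.

Lemma size_children s : size (children s) = sumn s.
Proof. by elim: s => //= l s IHs; rewrite children_cons size_cat size_iota IHs. Qed.

Lemma children_gt0 s : all (leq 1) (children s).
Proof.
elim: s => // l s IHs; rewrite children_cons all_cat IHs andbT.
by apply/allP => i; rewrite mem_iota => /andP[].
Qed.

Lemma lasts_gt0 n d : all (leq 1) (lasts n.+1 d).
Proof. by case: d => [|d] //=; apply: children_gt0. Qed.

Lemma lastsS n d : lasts n d.+1 = children (lasts n d).
Proof. by []. Qed.

Lemma filter_iota1 l : [seq i <- iota 1 l | 1 < i] = iota 2 l.-1.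
Proof.
case: l => //= l; apply/all_filterP/allP => i.
by rewrite mem_iota => /andP[].
Qed.

(** In a block [1, ..., l] the entries at least 2, lowered by one, are [1, ..., l-1], the block of a
    node with [l-1] children. *)
Lemma children_pred_filter s :
  map predn (filter (leq 2) (children s)) = children (map predn (filter (leq 2) s)).
Proof.
elim: s => // l s IHs; rewrite children_cons filter_cat map_cat IHs /=.
rewrite filter_iota1 (iotaDl 1 1) -map_comp (eq_map (g := id)) // map_id.
by case: l => [|[|l]].
Qed.

Lemma prefix_children s t : prefix s t -> prefix (children s) (children t).
Proof. by move/prefixP => [u ->]; rewrite children_cat prefix_prefix. Qed.

(** The monomials free of the last variable correspond, after renumbering, to those free of the
    first variable, and the latter come first in increasing lexicographic order. *)
Lemma lasts_pred_filter n d :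
  prefix (map predn (filter (leq 2) (lasts n d.+1))) (lasts n d.+1).
Proof.
elim: d => [|d IHd]; last first.
  by rewrite (lastsS _ d.+1) children_pred_filter prefix_children.
rewrite [lasts n 1]cats0 filter_iota1.
case: n => // n; rewrite (iotaDl 1 1) -map_comp (eq_map (g := id)) // map_id.
by rewrite -[n.+1 in X in prefix _ X](addn1 n) iotaD; exact: prefix_prefix.
Qed.

Lemma filter_children_head s x t :
  filter (leq 2) (children s) = x :: t -> x = 2.
Proof.
elim: s => // l s IHs; rewrite children_cons filter_cat filter_iota1.
by case: l => [|[|l]]; [exact: IHs | exact: IHs | case].
Qed.

Lemma take_children s c : 0 < c <= size (children s) ->
  exists s1 l s2 j, [/\ s = s1 ++ l :: s2, 0 < j <= l
    & take c (children s) = children s1 ++ iota 1 j].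
Proof.
elim: s c => [|l s IHs] c; first by case: c.
rewrite children_cons size_cat size_iota => /andP[c0 cle].
have [cl|lc] := leqP c l.
  exists [::], l, s, c; split; rewrite ?c0 //.
  by rewrite takel_cat ?size_iota // -{1}(subnKC cl) iotaD take_size_cat ?size_iota.
have [|s1 [l' [s2 [j [-> jl tk]]]]] := IHs (c - l); first by lia.
exists (l :: s1), l', s2, j; split => //.
by rewrite take_cat size_iota ltnNge (ltnW lc) /= tk children_cons catA.
Qed.

Lemma count_lt2_children s : count (gtn 2) (children s) <= size s.
Proof.
elim: s => // l s IHs; rewrite children_cons count_cat -[size _]/(1 + size s).
apply: leq_add IHs; case: l => // l; rewrite /= -leq_subRL // subnn leqn0 -leqn0 leqNgt.
by rewrite -has_count; apply/hasPn => i; rewrite mem_iota /= -leqNgt => /andP[].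
Qed.

Lemma count_lt2_children_gt0 s : all (leq 1) s -> count (gtn 2) (children s) = size s.
Proof.
move=> s0; apply/eqP; rewrite eqn_leq count_lt2_children /=.
elim: s s0 => //= l s IHs /andP[l0 s0]; rewrite children_cons count_cat.
by case: l l0 => // l _; rewrite -[(size s).+1]add1n leq_add ?IHs //= leq_addr.
Qed.

Lemma count_ge2_lt2 s : count (leq 2) s + count (gtn 2) s = size s.
Proof.
rewrite -(count_predC (leq 2) s); congr (_ + _).
by apply: eq_count => i /=; rewrite -ltnNge.
Qed.

Lemma count_eq2_filter_children s :
  count (pred1 2) (filter (leq 2) (children s)) = count (leq 2) s.
Proof.
elim: s => //= l s IHs; rewrite children_cons filter_cat count_cat IHs filter_iota1.
congr (_ + _); case: l => [|[|l]] //=.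
by rewrite (_ : count _ _ = 0) //; apply/eqP; rewrite -leqn0 leqNgt -has_count;
  apply/hasPn => i; rewrite mem_iota /=; lia.
Qed.

Lemma leq_count_take (T : Type) (a : pred T) m1 m2 (s : seq T) :
  m1 <= m2 -> count a (take m1 s) <= count a (take m2 s).
Proof.
by move=> le12; rewrite -(take_takel s le12) -{2}(cat_take_drop m1 (take m2 s))
  count_cat leq_addr.
Qed.

(* If [p] exceeds the number of last-variable-free monomials among the first
   [c], the first [p] of these reach beyond the first [c] monomials. The block
   of children in which they end, and each earlier block of at least two
   children, contribute an entry 2. These entries correspond to
   the multiples of the last variable among the first [p] monomials, through
   the shift of the variables expressed by the prefix hypothesis. *)
Lemma lastfree_bound s c p (t := children s) :
    prefix (map predn (filter (leq 2) t)) t ->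
    c <= size t -> p <= c -> p <= count (leq 2) t ->
    p <= lastfree t p + lastfree s (c - p) ->
  p <= lastfree t c.
Proof.
move=> pre ct pc pt; apply: contraTT; rewrite -!ltnNge => ltp.
have [|s1 [l [s2 [j [es jl tk]]]]] := @take_children s c.
  by rewrite ct andbT (leq_trans _ pc) // (leq_ltn_trans _ ltp).
have cE : c = count (leq 2) (children s1) + count (gtn 2) (children s1) + j.
  by rewrite count_ge2_lt2 -(size_takel ct) tk size_cat size_iota.
have jE : iota 1 j = 1 :: iota 2 j.-1 by case: (j) jl => // -[].
have freeE : lastfree t c = count (leq 2) (children s1) + j.-1.
  rewrite /lastfree tk count_cat jE /= add0n; congr (_ + _).
  rewrite -[RHS](size_iota 2); apply/eqP; rewrite -all_count; apply/allP => i.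
  by rewrite mem_iota => /andP[].
have ltp' : count (leq 2) (children s1) + j.-1 < p by rewrite -freeE.
have les1 := count_lt2_children s1.
have free_s : lastfree s (c - p) <= count (leq 2) s1.
  rewrite -(take_size_cat (l :: s2) (erefl (size s1))) -es.
  by apply: leq_count_take; lia.
have twos : count (gtn 2) (take p t) = count (pred1 2) (take p (filter (leq 2) t)).
  move: pre => /prefixP[u tE].
  rewrite [in LHS]tE takel_cat ?size_map ?size_filter // -map_take count_map.
  apply: eq_in_count => i /mem_take; rewrite mem_filter /= => /andP[].
  by case: i => [|[|[|]]].
(* The blocks of [s1] account for [count (leq 2) s1] entries 2. The first [p] free entries go
   further, and the next one is again the second of its block, hence a 2. *)
have : count (leq 2) s1 < count (pred1 2) (take p (filter (leq 2) t)).
  have {}ltp : count (leq 2) (children s1) + 1 <= p by lia.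
  have sz1 : size (filter (leq 2) (children s1)) = count (leq 2) (children s1).
    by rewrite size_filter.
  apply: leq_trans (leq_count_take _ _ ltp).
  have := pt; rewrite /t es children_cat count_cat.
  rewrite filter_cat take_cat sz1; case: ifP => [|_]; first by rewrite addn1 ltnNge leqnSn.
  rewrite addKn count_cat count_eq2_filter_children => /(leq_trans ltp); rewrite leq_add2l.
  rewrite -size_filter; case E: (filter _ _) => [|x u] // _.
  by rewrite (filter_children_head E) /= take0 /= addn1.
rewrite -twos; have := count_ge2_lt2 (take p t).
by rewrite size_takel ?(leq_trans pc) // -/(lastfree t p); lia.
Qed.

(** Each block has a single entry 1, at its start, so [b - lastfree t b] counts the blocks met by
    the first [b] children. By hypothesis there are at most [c] of them. *)
Lemma growth_bound s b c (t := children s) :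
    all (leq 1) s -> b <= size t -> b <= c + lastfree t b -> b <= sumn (take c s).
Proof.
move=> s0 bt; case: (posnP b) => [-> //|b0].
have [|s1 [l [s2 [j [es jl tk]]]]] := @take_children s b; first by rewrite b0.
have bE : b = size (children s1) + j by rewrite -(size_takel bt) tk size_cat size_iota.
have s10 : all (leq 1) s1 by move: s0; rewrite es all_cat => /andP[].
have jE : iota 1 j = 1 :: iota 2 j.-1 by case: (j) jl => // -[].
have freeE : lastfree t b + size s1 + 1 <= b.
  rewrite /lastfree tk count_cat jE /= add0n [leqRHS]bE -(count_ge2_lt2 (children s1)).
  rewrite (count_lt2_children_gt0 s10).
  by have := count_size (leq 2) (iota 2 j.-1); rewrite size_iota; lia.
move=> le; have {freeE le} : (size s1).+1 <= c by lia.
rewrite es => lec; rewrite take_cat ltnNge (ltnW lec) /=.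
rewrite subnE -subnE; case E: (c - size s1) => [|i]; first by lia.
by rewrite sumn_cat /= bE size_children; lia.
Qed.

End LexCounting.

(** * The increasing lexicographic list of monomials *)

Section LexList.
Variable r : nat.
Implicit Types (m a b : 'X_{1..r.+1}) (i j : 'I_r.+1) (d h : nat).

(** A larger index means a smaller variable. For the monomial 1 the empty maximum 0 gives the root
    all [r.+1] children. *)
Definition top_var m : nat := \max_(i < r.+1 | m i != 0) i.

Definition nchildren m : nat := r.+1 - top_var m.

(** [k] is the rank of the variable counted from the last one, so the children are listed in
    increasing order. *)
Definition mchildren m : seq 'X_{1..r.+1} :=
  [seq (m + U_(inord (r.+1 - k)))%MM | k <- iota 1 (nchildren m)].

Definition lexinc d : seq 'X_{1..r.+1} :=
  iter d (fun s => flatten (map mchildren s)) [:: 0%MM].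

Lemma lexincS d : lexinc d.+1 = flatten (map mchildren (lexinc d)).
Proof. by []. Qed.

Lemma top_var_ge m i : m i != 0 -> i <= top_var m.
Proof. by move=> mi; rewrite /top_var (bigD1 i) //= leq_maxl. Qed.

Lemma top_var_le m k : (forall i : 'I_r.+1, m i != 0 -> i <= k) -> top_var m <= k.
Proof. by move=> le; apply/bigmax_leqP. Qed.

Lemma top_var_ltS m : top_var m < r.+1.
Proof. by rewrite ltnS; apply: top_var_le => i _; rewrite -ltnS. Qed.

Lemma mchildrenP m a : reflect (exists2 i : 'I_r.+1, top_var m <= i & a = (m + U_(i))%MM)
  (a \in mchildren m).
Proof.
have ltS := top_var_ltS m.
apply: (iffP mapP) => [[j]|[i lei ->]].
  rewrite mem_iota /nchildren => jr ->; exists (inord (r.+1 - j)) => //.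
  by rewrite inordK; lia.
exists (r.+1 - i); first by rewrite mem_iota /nchildren; have := ltn_ord i; lia.
by rewrite subKn 1?ltnW // inord_val.
Qed.

Lemma nchildren_child m (j : nat) : 0 < j <= nchildren m ->
  nchildren (m + U_(inord (r.+1 - j)))%MM = j.
Proof.
rewrite /nchildren; have := top_var_ltS m; set i := inord _ => ltS jr.
have iE : i = r.+1 - j :> nat by rewrite inordK; lia.
suff -> : top_var (m + U_(i))%MM = i by rewrite iE; lia.
apply/eqP; rewrite eqn_leq; apply/andP; split.
  apply: top_var_le => i'; rewrite mnmDE mnm1E.
  by have [<- //|_] := eqVneq i i'; rewrite addn0 => /top_var_ge; lia.
by apply: top_var_ge; rewrite mnmDE mnm1E eqxx addn1.
Qed.

Lemma map_nchildren d : map nchildren (lexinc d) = lasts r.+1 d.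
Proof.
elim: d => [|d IHd].
  rewrite /= /nchildren (_ : top_var _ = 0) ?subn0 //.
  by apply/eqP; rewrite -leqn0; apply: top_var_le => i; rewrite mnm0E.
rewrite lexincS lastsS -IHd; elim: (lexinc d) => //= m s IHs.
rewrite children_cons map_cat IHs -map_comp; congr (_ ++ _).
rewrite -[RHS]map_id; apply/eq_in_map => j; rewrite mem_iota add1n ltnS.
exact: nchildren_child.
Qed.

Lemma size_lexinc d : size (lexinc d) = size (lasts r.+1 d).
Proof. by rewrite -map_nchildren size_map. Qed.

Lemma mem_lexinc d m : (m \in lexinc d) = (mdeg m == d).
Proof.
elim: d m => [|d IHd] m; first by rewrite inE mdeg_eq0.
rewrite lexincS; apply/flatten_mapP/eqP => [[a]|md].
  by rewrite IHd => /eqP <- /mchildrenP[i _ ->]; rewrite mdegD mdeg1 addn1.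
(* The parent of [m] is its quotient by the smallest variable dividing it. *)
have [i mi topi] : exists2 i : 'I_r.+1, m i != 0 & forall j : 'I_r.+1, m j != 0 -> j <= i.
  have : m != 0%MM by rewrite -mdeg_eq0 md.
  have [/existsP[i0 mi0] _|] := boolP [exists i, m i != 0].
    case: (@arg_maxnP _ i0 (fun i => m i != 0) (fun i => val i) mi0) => i mi top.
    by exists i.
  rewrite negb_exists => /forallP m0 /eqP[]; apply/mnmP => i.
  by rewrite mnm0E; apply/eqP/negPn.
have Um : (U_(i) <= m)%MM by rewrite lep1mP.
exists (m - U_(i))%MM.
  by rewrite IHd -(eqn_add2r 1) -{1}(mdeg1 i) -mdegD submK // md addn1.
apply/mchildrenP; exists i; last by rewrite submK.
by apply: top_var_le => j; rewrite mnmBE => mj; apply: topi; apply: contra_neq mj => ->.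
Qed.

(** The first exponent where [m] and [a] differ has index below [i]: otherwise [m] would have
    smaller degree than [a]. So the factor of index [i] does not affect the comparison, and the
    factor of index [j] can only enlarge the right-hand side. *)
Lemma ltm_child m a i j : mdeg m = mdeg a -> (m < a)%O -> top_var m <= i ->
  ((m + U_(i))%MM < (a + U_(j))%MM)%O.
Proof.
move=> eqd /(ltmcP eqd)[i0 eq0 lt0] topi.
have lt0i : i0 < i.
  rewrite ltnNge; apply: contraPN (eqd) => le; apply/eqP; rewrite ltn_eqF //.
  rewrite !mdegE (bigD1 i0) //= [ltnRHS](bigD1 i0) //= -addSn.
  apply: leq_add lt0 _; apply: leq_sum => k ki0.
  have [ltk|lek] := ltnP k i0; first by rewrite eq0.
  have [->//|/top_var_ge mk] := eqVneq (m k) 0.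
  by case/eqP: ki0; apply/val_inj/eqP; rewrite eqn_leq lek (leq_trans mk (leq_trans topi le)).
have neq (k1 k2 : 'I_r.+1) : k1 < k2 -> (k2 == k1) = false.
  by move=> lt; rewrite -val_eqE gtn_eqF.
apply/ltmcP; first by rewrite !mdegD eqd !mdeg1.
have [ltj|lej] := ltnP j i0.
  exists j => [k ltk|]; rewrite !mnmDE !mnm1E eq0 ?(ltn_trans ltk) //.
    by rewrite !neq // (ltn_trans ltk) // (ltn_trans ltj).
  by rewrite eqxx neq ?(ltn_trans ltj) // addn0 addn1.
exists i0 => [k ltk|]; rewrite !mnmDE !mnm1E.
  by rewrite eq0 // (neq _ _ (leq_trans ltk lej)) (neq _ _ (ltn_trans ltk lt0i)).
by rewrite neq // addn0 ltn_addr.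
Qed.

Lemma ltm_U i j : j < i -> (U_(i)%MM < U_(j)%MM :> 'X_{1..r.+1})%O.
Proof.
move=> lt; have neq (k1 k2 : 'I_r.+1) : k1 < k2 -> (k2 == k1) = false.
  by move=> lt'; rewrite -val_eqE gtn_eqF.
apply/ltmcP; rewrite ?mdeg1 //; exists j => [k ltk|]; rewrite !mnm1E.
  by rewrite !neq // (ltn_trans ltk).
by rewrite eqxx neq.
Qed.

Lemma sorted_mchildren m : sorted <%O (mchildren m).
Proof.
have homo : {in iota 1 (nchildren m) &, {homo (fun k => (m + U_(inord (r.+1 - k)))%MM)
    : k1 k2 / k1 < k2 >-> (k1 < k2)%O}}.
  have ltS := top_var_ltS m; move=> k1 k2; rewrite !mem_iota /nchildren => r1 r2 lt.
  by rewrite ltmc_add2r; apply: ltm_U; rewrite !inordK; lia.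
exact: homo_sorted_in homo _ (iota_ltn_sorted _ _).
Qed.

Lemma sorted_lexinc d : sorted <%O (lexinc d).
Proof.
elim: d => // d IHd; rewrite lexincS.
have : {in lexinc d, forall a, mdeg a == d} by move=> a; rewrite mem_lexinc.
elim: (lexinc d) IHd => //= a s IHs srt dega.
have dega' : {in s, forall b, mdeg b == d} by move=> b bs; rewrite dega // inE bs orbT.
have /= := IHs (path_sorted srt) dega'; have := sorted_mchildren a.
rewrite !(sorted_pairwise lt_trans) pairwise_cat => -> ->; rewrite !andbT.
apply/allrelP => b c /mchildrenP[i topi ->] /flatten_mapP[a' a's /mchildrenP[j _ ->]].
apply: ltm_child => //.
  by rewrite (eqP (dega a _)) ?mem_head // (eqP (dega' a' _)).
by move: srt => /(order_path_min lt_trans)/allP/(_ _ a's).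
Qed.

Lemma uniq_lexinc d : uniq (lexinc d).
Proof. exact: (sorted_uniq lt_trans (@ltxx _ _) (sorted_lexinc d)). Qed.

Lemma lex_monomialsE d : lex_monomials r d = rev (lexinc d).
Proof.
rewrite /lex_monomials; set s := [seq a <- _ | _].
apply: (sorted_eq (leT := >=%O)).
- by move=> b a c; apply: ge_trans.
- exact: ge_anti.
- by apply: sort_sorted; apply: ge_total.
- by rewrite rev_sorted; apply: sub_sorted (sorted_lexinc d) => a b /ltW.
apply: (perm_trans (permEl (perm_sort _ _))); rewrite perm_sym perm_rev perm_sym.
apply: uniq_perm.
- by rewrite filter_uniq // map_inj_uniq ?enum_uniq //; apply: val_inj.
- exact: uniq_lexinc.
move=> m; rewrite mem_lexinc mem_filter andb_idr // => /eqP md.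
have mb : mdeg m < d.+1 by rewrite md.
by apply/mapP; exists (BMultinom mb); rewrite ?mem_enum.
Qed.

Lemma take_lex_monomials d h : h <= size (lexinc d) ->
  take (size (lexinc d) - h) (lex_monomials r d) = rev (drop h (lexinc d)).
Proof. by move=> hs; rewrite lex_monomialsE take_rev subKn. Qed.

Lemma drop_lexinc_up d h a b : mdeg b = d ->
  a \in drop h (lexinc d) -> (a <= b)%O -> b \in drop h (lexinc d).
Proof.
move=> /eqP; rewrite -mem_lexinc -{1}(cat_take_drop h (lexinc d)) mem_cat.
case/orP => // bt ad; have := sorted_lexinc d.
rewrite -{1}(cat_take_drop h (lexinc d)) (sorted_pairwise lt_trans) pairwise_cat.
by case/andP => /allrelP/(_ b a bt ad); rewrite ltNge => /negbTE ->.
Qed.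

(** If the parent [b] of the product were among the first [h] monomials, then [b < a], and
    [ltm_child] would make the product smaller than itself. So the product comes after all children
    of those monomials, which number at least [h']. *)
Lemma drop_lexinc_mul d h h' a i : h' <= sumn (take h (lasts r.+1 d)) ->
  a \in drop h (lexinc d) -> (a + U_(i))%MM \in drop h' (lexinc d.+1).
Proof.
move=> leh ad.
have dega : mdeg a = d by apply/eqP; rewrite -mem_lexinc (mem_drop ad).
have : (a + U_(i))%MM \in lexinc d.+1 by rewrite mem_lexinc mdegD mdeg1 dega addn1.
rewrite lexincS -{1}(cat_take_drop h (lexinc d)) map_cat flatten_cat mem_cat.
have szt : h' <= size (flatten (map mchildren (take h (lexinc d)))).
  apply: leq_trans leh _; rewrite size_flatten /shape -map_nchildren -map_take -map_comp.
  by rewrite (eq_map (g := size \o mchildren)) // => m /=; rewrite size_map size_iota.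
case/orP => [|abd].
  case/flatten_mapP => b bt /mchildrenP[j topj E].
  have ltb : (b < a)%O.
    have := sorted_lexinc d.
    rewrite -{1}(cat_take_drop h (lexinc d)) (sorted_pairwise lt_trans) pairwise_cat.
    by case/andP => /allrelP/(_ b a bt ad).
  have degb : mdeg b = d by apply/eqP; rewrite -mem_lexinc (mem_take bt).
  by have := ltm_child i (etrans degb (esym dega)) ltb topj; rewrite -E ltxx.
rewrite -{1}(cat_take_drop h (lexinc d)) map_cat flatten_cat drop_cat.
case: ltnP => [_|szh]; first by rewrite mem_cat abd orbT.
by rewrite (eqP (_ : _ - _ == 0)) ?drop0 // subn_eq0.
Qed.

End LexList.

Local Open Scope ring_scope.

Lemma classical_argmax (T : Type) (x0 : T) (f : T -> nat) (b : nat) :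
  (forall x, f x <= b)%N -> exists x, forall y, (f y <= f x)%N.
Proof.
move=> fb; have [n] : exists n, (b - f x0 <= n)%N by exists (b - f x0)%N.
elim: n x0 => [|n IHn] x0 le.
  by exists x0 => y; apply: leq_trans (fb y) _; rewrite -subn_eq0 -leqn0.
case: (classic (exists y, (f x0 < f y)%N)) => [[y lt]|nex].
  by apply: (IHn y); have := fb y; lia.
by exists x0 => y; rewrite leqNgt; apply/negP => lt; apply: nex; exists y.
Qed.

(** * Nonvanishing of polynomials in characteristic zero *)

Section MpolyNonzero.
Variable k : fieldType.
Hypothesis char0 : [pchar k] =i pred0.

Lemma poly_nonroot (p : {poly k}) : p != 0 -> exists t, p.[t] != 0.
Proof.
have nat0 : forall n, (n%:R == 0 :> k) = (n == 0)%N by apply/pcharf0P.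
have inj : injective (fun n => n%:R : k).
  move=> a b; wlog le : a b / (a <= b)%N => [H|] /= /eqP.
    by case/orP: (leq_total a b) => le /eqP E; [exact: H | apply/esym/H].
  rewrite eq_sym -subr_eq0 -natrB // nat0 subn_eq0 => le'.
  by apply/eqP; rewrite eqn_leq le.
(* Characteristic zero makes these [size p] elements distinct, one more than the degree of [p]. *)
move=> p0; pose s := [seq n%:R : k | n <- iota 0 (size p)].
have us : uniq s by rewrite map_inj_uniq ?iota_uniq.
have : ~~ all (root p) s.
  by apply/negP => /(max_poly_roots p0)/(_ us); rewrite size_map size_iota ltnn.
by rewrite -has_predC => /hasP[t _ pt]; exists t.
Qed.

(** Induction on the number of variables: a nonzero coefficient of [p], seen as univariate in the
    last variable, is nonzero at some [v]; it remains to avoid the roots in the last variable. *)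
Lemma mpoly_nonroot n (p : {mpoly k[n]}) : p != 0 -> exists v, p.@[v] != 0.
Proof.
elim: n p => [|n IHn] p p0.
  by exists (fun _ => 0); move: p0; rewrite [p]nvar0_mpolyC mevalC mpolyC_eq0.
have [m mp] : exists m, p@_m != 0.
  apply: NNPP => nex; case/negP: p0; apply/eqP/mpolyP => m.
  by rewrite mcoeff0; apply/eqP/negPn/negP => pm; apply: nex; exists m.
pose res (m : 'X_{1..n.+1}) := [multinom m (widen_ord (leqnSn n) i) | i < n].
have widenE i : widen_ord (leqnSn n) i = lift ord_max i.
  by apply: val_inj; rewrite [RHS]lift_max.
have res_inj a b : res a = res b -> a ord_max = b ord_max -> a = b.
  move=> /mnmP eqr eqm; apply/mnmP => i; case: (unliftP ord_max i) => [j ->|-> //].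
  by have := eqr j; rewrite !mnmE widenE.
have cq : ((muni p)`_(m ord_max))@_(res m) != 0.
  rewrite muniE coef_sum raddf_sum /= (bigD1_seq m) ?msupp_uniq ?mcoeff_msupp //=.
  rewrite coefZ coefXn eqxx mulr1 mcoeffZ mcoeffX eqxx mulr1 big1 ?addr0 // => m' ne.
  rewrite coefZ coefXn; case: eqP => [eqm|_]; last by rewrite mulr0 mcoeff0.
  rewrite mulr1 mcoeffZ mcoeffX; case: eqP => [eqr|_]; last by rewrite mulr0.
  by case/eqP: ne; apply: res_inj.
have [|v vq] := IHn (muni p)`_(m ord_max).
  by apply: contraNneq cq => ->; rewrite mcoeff0.
have [|t tq] := @poly_nonroot (map_poly (meval v) (muni p)).
  by apply: contraNneq vq => /(congr1 (coefp (m ord_max))) /=; rewrite coef_map coef0 => ->.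
pose w (i : 'I_n.+1) := if unlift ord_max i is Some j then v j else t.
exists w; rewrite (_ : _.@[w] = (map_poly (meval v) (muni p)).[t]) //.
rewrite muniE mevalE !raddf_sum /= horner_sum; apply: eq_bigr => m' _.
rewrite -!mul_polyC rmorphM rmorphXn /= map_polyC map_polyX /= mevalZ mevalX.
rewrite hornerM hornerXn hornerC -mulrA; congr (_ * _).
rewrite big_ord_recr /= /w unlift_none; congr (_ * _); apply: eq_bigr => i _.
by rewrite mnmE widenE liftK.
Qed.

End MpolyNonzero.

(** * Dimension of the sum with an image *)

Section LinAlg.
Variables (K : fieldType) (aT rT : vectType K).
Implicit Types (f : 'Hom(aT, rT)) (V : {vspace rT}).

(** Rank-nullity for the composite of [f] with the projection to [rT / V]. *)
Lemma dim_add_limg f V :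
  (\dim (V + limg f) + \dim (f @^-1: V) = \dim V + \dim {:aT})%N.
Proof.
have := limg_ker_dim f (f @^-1: V); rewrite -lpreim_cap_limg.
have := limg_ker_dim f fullv; rewrite capfv => <-.
rewrite lpreimK ?capvSr // => <-.
have -> : (f @^-1: (V :&: limg f) :&: lker f = lker f)%VS.
  by apply/capv_idPr; rewrite -lpreim0 lpreimS // sub0v.
by have := dimv_sum_cap V (limg f); lia.
Qed.

End LinAlg.

(** * Homogeneous components and generic linear forms *)

Section Homog.
Variables (k : fieldType) (r : nat).
Local Notation R := {mpoly k[r.+1]}.
Local Notation R_ d := (dhomog r.+1 k d).
Implicit Types (L : R_ 1).

Definition mspan d (s : seq 'X_{1..r.+1}) : {vspace R_ d} :=
  <<[seq indhomog d 'X_[k, a] | a <- s]>>%VS.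

Lemma mpoly_indhomogX d a : mdeg a = d -> (indhomog d 'X_[k, a] : R) = 'X_[a].
Proof. by move=> da; rewrite [LHS]insubdK //= dhomogX; apply/eqP. Qed.

Lemma mem_mspan d (s : seq 'X_{1..r.+1}) (f : R_ d) :
  {in s, forall a, mdeg a = d} ->
  (f \in mspan d s) = all (mem s) (msupp (f : R)).
Proof.
move=> ds; apply/idP/allP => [fs m|sf].
  rewrite mcoeff_msupp; apply: contraR => ms.
  rewrite (@coord_span _ _ _ (in_tuple [seq indhomog d 'X_[k, a] | a <- s]) f fs).
  rewrite linear_sum raddf_sum /= big1 // => i _.
  have lti : (i < size s)%N by rewrite -(size_map (fun a => indhomog d 'X_[k, a])) ltn_ord.
  rewrite linearZ /= (nth_map 0%MM); last exact: lti.
  set a := nth _ _ _; have ain : a \in s by apply: mem_nth lti.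
  rewrite /= mpoly_indhomogX ?ds // mcoeffX; case: eqP => [eam|_]; last by rewrite mulr0.
  by move: ms; rewrite /= -eam ain.
have -> : f = \sum_(m <- msupp (f : R)) (f : R)@_m *: indhomog d 'X_[k, m].
  apply: val_inj; rewrite /= linear_sum /= [LHS]mpolyE; apply: eq_big_seq => m mf.
  by rewrite mpoly_indhomogX ?(dhomog_mf (dhomog_is_dhomog f) mf).
rewrite big_seq rpred_sum // => m mf; apply: rpredZ; apply: memv_span.
by apply: map_f; apply: sf.
Qed.

Lemma dim_mspan d (s : seq 'X_{1..r.+1}) :
  uniq s -> {in s, forall a, mdeg a = d} -> \dim (mspan d s) = size s.
Proof.
move=> us ds; suff : free [seq indhomog d 'X_[k, a] | a <- s].
  by move/eqP => ->; rewrite size_map.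
elim: s us ds => [|a s IHs] /=; first by rewrite nil_free.
case/andP => nas us ds; rewrite free_cons.
have ds' : {in s, forall b, mdeg b = d} by move=> b bs; apply: ds; rewrite inE bs orbT.
rewrite [free _]IHs // andbT -[<<_>>%VS]/(mspan d s) mem_mspan //.
by rewrite mpoly_indhomogX ?ds ?mem_head // msuppX /= andbT.
Qed.

Lemma dim_dhomog d : \dim {: R_ d} = size (lexinc r d).
Proof.
have ds : {in lexinc r d, forall a, mdeg a = d} by move=> a; rewrite mem_lexinc => /eqP.
rewrite -(dim_mspan (uniq_lexinc r d) ds); congr (\dim _); apply/esym/eqP.
rewrite eqEsubv subvf; apply/subvP => f _; rewrite mem_mspan //; apply/allP => m mf.
by rewrite /= mem_lexinc (dhomog_mf (dhomog_is_dhomog f) mf).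
Qed.

Lemma mul_form_is_linear d L : linear (@mul_form k r d L).
Proof. by move=> c f g; apply: val_inj; rewrite /= mulrDr scalerAr. Qed.

HB.instance Definition _ d L :=
  GRing.isLinear.Build k (R_ d) (R_ d.+1) _ (@mul_form k r d L) (mul_form_is_linear L).

Definition mulL d L : 'Hom(R_ d, R_ d.+1) := linfun (@mul_form k r d L).

Lemma mulLE d L (f : R_ d) : (mulL d L f : R) = (L : R) * f.
Proof. by rewrite lfunE. Qed.

Definition linvar (i : 'I_r.+1) : R_ 1 := indhomog 1 'X_[k, U_(i)].

Lemma linvarE i : (linvar i : R) = 'X_i.
Proof. by rewrite mpoly_indhomogX ?mdeg1. Qed.

Definition lincoef L (i : 'I_r.+1) : k := (L : R)@_(U_(i)).

Lemma linformE L : L = \sum_i lincoef L i *: linvar i.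
Proof.
apply: val_inj; apply/mpolyP => m /=; rewrite linear_sum raddf_sum /=.
have [m1|m1] := eqVneq (mdeg m) 1%N; last first.
  rewrite (dhomog_nemf_coeff (dhomog_is_dhomog L)) // big1 // => i _.
  rewrite linvarE mcoeffZ mcoeffX; case: eqP => [em|_]; last by rewrite mulr0.
  by rewrite -em mdeg1 in m1.
have /mdeg1P[i /eqP ->] : mdeg m == 1%N by rewrite m1.
rewrite (bigD1 i) //= linvarE mcoeffZ mcoeffX eqxx mulr1 big1 ?addr0 // => j ne.
by rewrite linvarE mcoeffZ mcoeffX eq_mnm1 (negbTE ne) mulr0.
Qed.

Lemma mulL_lincoef d L (f : R_ d) :
  mulL d L f = \sum_i lincoef L i *: mulL d (linvar i) f.
Proof.
apply: val_inj; rewrite /= mulLE {1}(linformE L) !linear_sum /= mulr_suml.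
by apply: eq_bigr => i _; rewrite mulLE -scalerAl.
Qed.

(** The polynomial [p] witnesses a nonempty principal open set, so conjunctions reduce to products
    in a domain. *)
Definition generic (P : R_ 1 -> Prop) :=
  exists2 p : R, p != 0 & forall L, p.@[lincoef L] != 0 -> P L.

Lemma generic_and P Q : generic P -> generic Q -> generic (fun L => P L /\ Q L).
Proof.
move=> [p p0 pP] [q q0 qQ]; exists (p * q); first by rewrite mulf_neq0.
by move=> L; rewrite mevalM mulf_eq0 negb_or => /andP[/pP ? /qQ ?].
Qed.

Lemma generic_sub P Q : (forall L, P L -> Q L) -> generic P -> generic Q.
Proof. by move=> PQ [p p0 pP]; exists p => // L /pP /PQ. Qed.

Lemma generic_all n (P : nat -> R_ 1 -> Prop) :
  (forall i, generic (P i)) -> generic (fun L => forall i, (i < n)%N -> P i L).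
Proof.
move=> gP; elim: n => [|n IHn]; first by exists 1; rewrite ?oner_neq0.
apply: generic_sub (generic_and IHn (gP n)) => L [PL PnL] i.
by rewrite ltnS leq_eqVlt => /orP[/eqP -> //|/PL].
Qed.

Lemma lincoef_sum (v : 'I_r.+1 -> k) : lincoef (\sum_i v i *: linvar i) =1 v.
Proof.
move=> i; rewrite /lincoef linear_sum raddf_sum /= (bigD1 i) //= linvarE mcoeffZ.
rewrite mcoeffX eqxx mulr1 big1 ?addr0 // => j ne.
by rewrite linvarE mcoeffZ mcoeffX eq_mnm1 (negbTE ne) mulr0.
Qed.

Hypothesis char0 : [pchar k] =i pred0.

Lemma generic_exists P : generic P -> exists L, P L.
Proof.
case=> p /(mpoly_nonroot char0)[v pv] pP; exists (\sum_i v i *: linvar i).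
by apply: pP; rewrite (meval_eq _ (lincoef_sum v)).
Qed.

(* The witness polynomial is the determinant of the coordinates, in a basis of
   [V + L0 R_d], of the vectors obtained by replacing [L0] by [L] in that basis. *)
Lemma generic_dim d (V : {vspace R_ d.+1}) L0 :
  generic (fun L => (\dim (V + limg (mulL d L0)) <= \dim (V + limg (mulL d L)))%N).
Proof.
set U0 := (V + _)%VS; pose N := \dim U0.
have split w : w \in U0 -> exists u : R_ d.+1 * R_ d, u.1 \in V /\ w = u.1 + mulL d L0 u.2.
  by case/memv_addP => v vV [_ /memv_imgP[f _ ->] ->]; exists (v, f).
pose t := vbasis U0; have /basis_free t_free := vbasisP U0.
have /fin_all_exists[u uP] (j : 'I_N) : exists u : R_ d.+1 * R_ d,
    u.1 \in V /\ t`_j = u.1 + mulL d L0 u.2.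
  by apply: split; apply: vbasis_mem; rewrite mem_nth // size_tuple.
pose w L (j : 'I_N) := (u j).1 + mulL d L (u j).2.
pose A L : 'M[k]_N := \matrix_(j, c) coord t c (w L j).
pose PA : 'M[R]_N := \matrix_(j, c) ((coord t c (u j).1)%:MP
   + \sum_i (coord t c (mulL d (linvar i) (u j).2))%:MP * 'X_i).
have PAE L : map_mx (meval (lincoef L)) PA = A L.
  apply/matrixP => j c; rewrite !mxE rmorphD /= mevalC rmorph_sum /=.
  rewrite linearD; congr (_ + _); rewrite mulL_lincoef linear_sum.
  by apply: eq_bigr => i _; rewrite rmorphM /= mevalC mevalXU linearZ /= mulrC.
have detE L : (\det PA).@[lincoef L] = \det (A L) by rewrite -PAE det_map_mx.
exists (\det PA) => [|L].
  have : (\det PA).@[lincoef L0] != 0.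
    rewrite detE (_ : A L0 = 1%:M) ?det1 ?oner_neq0 //.
    apply/matrixP => j c; rewrite !mxE /w.
    by have [_ <-] := uP j; rewrite coord_free // eq_sym.
  by apply: contraNneq => ->; rewrite meval0.
rewrite detE -unitfE => unitA.
pose X := [tuple w L j | j < N].
have XE (j : 'I_N) : X`_j = w L j by rewrite -tnth_nth tnth_mktuple.
have X_free : free X.
  apply/freeP => a aX j; pose av := \row_i a i.
  have avA : av *m A L = 0.
    apply/rowP => c; rewrite !mxE -[RHS](linear0 (coord t c)) -aX linear_sum.
    by apply: eq_bigr => i _; rewrite !mxE XE linearZ.
  have : av = 0.
    by rewrite -[av]mulmx1 -(mulmxV (unitA : A L \in unitmx)) mulmxA avA mul0mx.
  by move/rowP/(_ j); rewrite !mxE.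
rewrite -/N; have /eqP := X_free; rewrite size_tuple => <-.
apply: dimvS; apply/span_subvP => x.
case/mapP => j _ ->; apply: memv_add; first by case: (uP j).
exact: memv_img (memvf _).
Qed.

End Homog.

(** * The theorems of Green and Macaulay *)

Section Green.
Variables (k : fieldType) (r : nat).
Local Notation R := {mpoly k[r.+1]}.
Local Notation R_ d := (dhomog r.+1 k d).
Implicit Types (L : R_ 1).
Local Notation M := (lasts r.+1).

Lemma dim_lasts d : \dim {: R_ d} = size (M d).
Proof. by rewrite dim_dhomog size_lexinc. Qed.

(** Every monomial of positive degree is divisible by a variable. Hence some variable strictly
    enlarges a proper subspace. *)
Lemma limg_mulL_full d (V : {vspace R_ d.+1}) :
  (forall i, limg (mulL d (linvar k i)) <= V)%VS -> V = fullv.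
Proof.
move=> sV; apply/eqP; rewrite eqEsubv subvf; apply/subvP => f _.
have -> : f = \sum_(m <- msupp (f : R)) (f : R)@_m *: indhomog d.+1 'X_[k, m].
  apply: val_inj; rewrite /= linear_sum /= [LHS]mpolyE; apply: eq_big_seq => m mf.
  by rewrite mpoly_indhomogX ?(dhomog_mf (dhomog_is_dhomog f) mf).
rewrite big_seq rpred_sum // => m mf; apply: rpredZ.
have dm : mdeg m = d.+1 := dhomog_mf (dhomog_is_dhomog f) mf.
have [i mi] : exists i, m i != 0%N.
  apply/existsP; apply: contraPT (dm) => /existsPn m0; rewrite (_ : m = 0%MM) ?mdeg0 //.
  by apply/mnmP => i; rewrite mnm0E; apply/eqP/negPn/m0.
have Um : (U_(i) <= m)%MM by rewrite lep1mP.
have dmi : mdeg (m - U_(i))%MM = d.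
  by apply/eqP; rewrite -(eqn_add2r 1) -{1}(mdeg1 i) -mdegD submK // dm addn1.
rewrite (_ : indhomog _ _ = mulL d (linvar k i) (indhomog d 'X_[k, m - U_(i)])).
  by apply: subvP (sV i) _ (memv_img _ (memvf _)).
by apply: val_inj; rewrite /= mulLE linvarE !mpoly_indhomogX // -mpolyXD addmC submK.
Qed.

Lemma dim_limg_mulL d L : L != 0 -> \dim (limg (mulL d L)) = size (M d).
Proof.
move=> L0; rewrite -dim_lasts; apply: limg_dim_eq; rewrite capfv.
apply/eqP/lker0P => f g /(congr1 val) /=; rewrite !mulLE => E; apply: val_inj.
by apply: mulfI E; rewrite -(inj_eq val_inj) in L0.
Qed.

Lemma mulLC d L1 L2 (f : R_ d) : mulL d.+1 L1 (mulL d L2 f) = mulL d.+1 L2 (mulL d L1 f).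
Proof. by apply: val_inj; rewrite /= !mulLE mulrCA. Qed.

Hypothesis char0 : [pchar k] =i pred0.

Lemma dim_addv_gt d (V : {vspace R_ d}) (U : {vspace R_ d}) :
  ~~ (U <= V)%VS -> (\dim V < \dim (V + U))%N.
Proof.
move=> nUV; rewrite ltn_neqAle dimvS ?addvSl // andbT; apply: contra nUV => /eqP E.
have /eqP -> : V == (V + U)%VS by rewrite eqEdim addvSl E /=.
exact: addvSr.
Qed.

(** For Green's theorem in degree 1, where the last variable is the only monomial not counted. *)
Lemma lastfree_iota n c : (c <= n)%N -> (c <= (lastfree (iota 1 n) c).+1)%N.
Proof.
move=> cn; rewrite /lastfree take_iota (minn_idPl cn); case: c {cn} => // c.
rewrite -[c in leqLHS](size_iota 2) /= add0n ltnS (_ : count _ _ = size (iota 2 c)) //.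
by apply/eqP; rewrite -all_count; apply/allP => i; rewrite mem_iota => /andP[].
Qed.

(** The bound on the cokernel is written additively. Induction on [d], then on a bound [b] for the
    codimension of [V]; in degree 1 any linear form outside [V] works. *)
Theorem green d (V : {vspace R_ d.+1}) :
  exists L, (size (M d.+1) <= \dim (V + limg (mulL d L))
             + lastfree (M d.+1) (size (M d.+1) - \dim V))%N.
Proof.
have dimM n := dim_lasts n.
have dim_le n (U : {vspace R_ n}) : (\dim U <= size (M n))%N.
  by rewrite -dimM; apply: dimvS (subvf _).
have full n (U : {vspace R_ n}) : (fullv <= U)%VS -> (size (M n) <= \dim U)%N.
  by move=> /dimvS; rewrite dimM.
elim: d V => [|d IHd] V.
  have [fV|/subvPn[L _ LV]] := boolP (fullv <= V)%VS.
    exists 0; rewrite (leq_trans (full _ _ fV)) // (leq_trans _ (leq_addr _ _)) //.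
    by rewrite dimvS ?addvSl.
  exists L; have lt : (\dim V < \dim (V + limg (mulL 0 L)))%N.
    apply: dim_addv_gt; apply: contra LV => /subvP; apply.
    have {1}-> : L = mulL 0 L (DHomog (dhomog1 _ _)).
      by apply: val_inj; rewrite /= mulLE mulr1.
    exact: memv_img (memvf _).
  have M1 : M 1 = iota 1 r.+1 by apply: cats0.
  have := @lastfree_iota r.+1 (size (M 1) - \dim V).
  by rewrite M1 size_iota => /(_ (leq_subr _ _)); lia.
elim: {V}(_ - _)%N {-2}V (leqnn (size (M d.+2) - \dim V)) => [|b IHb] V leb.
  exists 0; apply: (leq_trans (n := \dim V)); first by lia.
  by rewrite (leq_trans _ (leq_addr _ _)) // dimvS ?addvSl.
have [L Lmax] := @classical_argmax _ (0 : R_ 1)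
  (fun L => \dim (V + limg (mulL d.+1 L))) (size (M d.+2)) (fun L => dim_le _ _).
exists L; set a := \dim (V + limg (mulL d.+1 L)).
have [fV|nfV] := boolP (fullv <= V)%VS.
  by rewrite (leq_trans (full _ _ fV)) // (leq_trans _ (leq_addr _ _)) // dimvS ?addvSl.
have lta : (\dim V < a)%N.
  apply: contraNltn nfV => leaV; rewrite (@limg_mulL_full _ V) // => i.
  apply/negPn/negP => /dim_addv_gt; rewrite ltnNge; case/negP.
  exact: leq_trans (Lmax _) leaV.
have L0 : L != 0.
  apply: contraTneq lta; rewrite /a -leqNgt => ->; apply: dimvS.
  rewrite subv_add subvv; apply/subvP => _ /memv_imgP[f _ ->].
  by rewrite (_ : mulL _ _ _ = 0) ?mem0v //; apply: val_inj; rewrite /= mulLE mul0r.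
(* In terms of A = R/V, the sequence 0 -> R/(V : L) -> A -> A/LA -> 0 is cut by
   a form L' generic for both ends: the inductive bounds apply to the ends, and
   the maximality of L bounds the middle term from below. *)
pose V' := (V + limg (mulL d.+1 L))%VS; pose W := (mulL d.+1 L @^-1: V)%VS.
have dimW := dim_add_limg (mulL d.+1 L) V; rewrite -/a -/W dimM in dimW.
have [L1 L1g] : exists L1, (size (M d.+2) <= \dim (V' + limg (mulL d.+1 L1))
     + lastfree (M d.+2) (size (M d.+2) - a))%N.
  by apply: IHb; rewrite -/a; have := dim_le _ V'; rewrite -/a; lia.
have [L2 L2g] := IHd W.
have [L' [L1' L2']] := generic_exists char0
  (generic_and (generic_dim V' L1) (generic_dim W L2)).
pose U := (V + limg (mulL d.+1 L'))%VS.
have Ua : (\dim U <= a)%N := Lmax L'.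
have dimU := dim_add_limg (mulL d.+1 L) U; rewrite dimM in dimU.
(* Reducing by [L'] and then by [L] is the same as reducing in the other order. *)
have UE : (U + limg (mulL d.+1 L) = V' + limg (mulL d.+1 L'))%VS.
  by rewrite /U /V' -!addvA (addvC (limg (mulL d.+1 L))).
have sW : (W + limg (mulL d L') <= mulL d.+1 L @^-1: U)%VS.
  rewrite subv_add lpreimS ?addvSl //=; apply/subvP => _ /memv_imgP[f _ ->].
  rewrite -memv_preim mulLC; apply: subvP (addvSr _ _) _ _; exact: memv_img (memvf _).
have := dimvS sW; rewrite UE in dimU => {}sW.
have a_le := dim_le _ V'; rewrite -/a in a_le.
(* [lastfree_bound] is applied with [c] the codimension of [V] and [p] that of [V']; then [c - p] is
   the codimension of [W]. *)
suff : (size (M d.+2) - a <= lastfree (M d.+2) (size (M d.+2) - \dim V))%N by lia.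
have MS : M d.+2 = children (M d.+1) by [].
have ones := count_lt2_children_gt0 (lasts_gt0 r d.+1).
have tot := count_ge2_lt2 (children (M d.+1)); rewrite ones -MS in tot.
(* As [L] is injective, [a] is at least the number of multiples of the last variable in degree
   [d.+2], whence [p <= count (leq 2) t]. *)
have : (size (M d.+1) <= a)%N by rewrite -(dim_limg_mulL d.+1 L0) dimvS // addvSr.
rewrite MS => Ma; apply: lastfree_bound; rewrite -?MS.
- exact: lasts_pred_filter.
- exact: leq_subr.
- by lia.
- by lia.
have arith (x w v m s : nat) : (x + w = v + m -> v < x -> x <= s ->
  s - v - (s - x) = m - w)%N by lia.
rewrite (arith _ _ _ _ _ dimW lta a_le).
have := leq_trans L2g (leq_add (leq_trans L2' sW) (leqnn _)).
have := leq_trans L1g (leq_add L1' (leqnn _)).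
move: Ua dimU; set x1 := \dim (mulL _ _ @^-1: U); set x2 := \dim (V' + _).
by set x3 := \dim U; set x4 := lastfree _ _; set x5 := lastfree _ _; clear; lia.
Qed.

(* [sumn (take c (lasts n d))] is Macaulay's bound [c^<d>]. *)
Lemma macaulay d (V : {vspace R_ d}) (W : {vspace R_ d.+1}) :
  (forall L f, f \in V -> mulL d L f \in W) ->
  (size (M d.+1) - \dim W <= sumn (take (size (M d) - \dim V) (M d)))%N.
Proof.
move=> VW; have [L Lg] := green W.
apply: growth_bound; [exact: lasts_gt0 | exact: leq_subr |].
(* Since [L] maps [V] into [W], the image of [R_d] modulo [W] has dimension at most the codimension
   of [V]; Green's theorem bounds the rest. *)
have sV : (V <= mulL d L @^-1: W)%VS.
  by apply/subvP => f /(VW L); rewrite memv_preim.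
have := dim_add_limg (mulL d L) W; have := dimvS sV; rewrite dim_lasts.
rewrite -lastsS; move: Lg; set x1 := \dim (W + _); set x2 := \dim (_ @^-1: _).
by set x3 := lastfree _ _; set x4 := \dim V; set x5 := \dim W; clear; lia.
Qed.

End Green.

(** * Hyperplane sections of lex-segment ideals *)

Section LexSection.
Variables (k : fieldType) (r : nat).
Local Notation R := {mpoly k[r.+1]}.
Local Notation R_ d := (dhomog r.+1 k d).
Implicit Types (L : R_ 1) (p q : R).
Local Notation M := (lasts r.+1).

Definition supp_above m p :=
  {in msupp p, forall m', mdeg m' = mdeg m /\ (m <= m')%O}.

Lemma supp_above1 : supp_above 0%MM 1.
Proof. by move=> m; rewrite msupp1 inE => /eqP ->. Qed.

Lemma supp_aboveM m1 m2 p q :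
  supp_above m1 p -> supp_above m2 q -> supp_above (m1 + m2)%MM (p * q).
Proof.
move=> s1 s2 m /msuppM_le/allpairsP[[a b] /= [/s1[da lea] /s2[db leb] ->]].
by rewrite !mdegD da db; split=> //; apply: lem_add.
Qed.

(* The substitution eliminating the last variable by means of [L = 0]. It
   preserves lexicographic segments since it only replaces variables by larger
   ones. *)
Definition elim_last L : (r.+1).-tuple R :=
  [tuple if i == ord_max then
     - (\sum_(j | j != ord_max) (lincoef L j / lincoef L ord_max) *: 'X_j)
   else 'X_i | i < r.+1].

Lemma supp_above_elim_last L m : supp_above m ('X_[m] \mPo elim_last L).
Proof.
rewrite comp_mpolyX {1}[m]multinomUE_id.
have sub (I : eqType) (s : seq I) (F : I -> 'X_{1..r.+1}) (G : I -> R) :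
    (forall i, supp_above (F i) (G i)) ->
  supp_above (\sum_(i <- s) F i)%MM (\prod_(i <- s) G i).
  move=> FG; elim: s => [|i s IHs]; first by rewrite !big_nil; apply: supp_above1.
  by rewrite !big_cons; apply: supp_aboveM.
apply: (sub) => i; elim: (m i) => [|n IHn].
  by rewrite mulm0n expr0; apply: supp_above1.
rewrite mulmS exprS; apply: supp_aboveM => // m'; rewrite tnth_mktuple.
case: eqP => [->|_]; last by rewrite msuppX inE => /eqP ->.
rewrite (perm_mem (msuppN _)) => /msupp_sum_le.
case/flattenP => t /mapP[j]; rewrite mem_filter => /andP[jmax _] -> /msuppZ_le.
rewrite msuppX inE => /eqP ->; rewrite !mdeg1; split=> //.
by apply/ltW/ltm_U; rewrite ltn_neqAle (inj_eq val_inj) jmax -ltnS ltn_ord.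
Qed.

Lemma elim_last_linform L : lincoef L ord_max != 0 -> (L : R) \mPo elim_last L = 0.
Proof.
move=> L0; rewrite {2}(linformE L) linear_sum /= linear_sum /= (bigD1 ord_max) //=.
rewrite !linearZ /= linvarE comp_mpolyXU -tnth_nth tnth_mktuple eqxx.
rewrite scalerN scaler_sumr addrC; apply/eqP; rewrite subr_eq0; apply/eqP.
apply: eq_bigr => i ni; rewrite !linearZ /= linvarE comp_mpolyXU -tnth_nth tnth_mktuple.
by rewrite (negbTE ni) scalerA divfK.
Qed.

Lemma elim_last_id L p :
  {in msupp p, forall m : 'X_{1..r.+1}, m ord_max = 0%N} -> p \mPo elim_last L = p.
Proof.
move=> p0; rewrite [p]mpolyE linear_sum /=; apply: eq_big_seq => m /p0 m0.
rewrite linearZ /= comp_mpolyX [in RHS]mpolyXE_id; congr (_ *: _).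
apply: eq_bigr => i _; rewrite tnth_mktuple.
by case: eqP => [->|//]; rewrite m0 !expr0.
Qed.

Lemma deg_lexinc d m : m \in lexinc r d -> mdeg m = d.
Proof. by rewrite mem_lexinc => /eqP. Qed.

Lemma lastfreeE d h :
  lastfree (M d.+1) h = size [seq m <- take h (lexinc r d.+1) | (1 < nchildren m)%N].
Proof. by rewrite /lastfree -map_nchildren -map_take count_map size_filter. Qed.

Lemma nchildren_last_free (m : 'X_{1..r.+1}) : (1 < nchildren m)%N -> m ord_max = 0%N.
Proof.
rewrite /nchildren; apply: contraTeq => /top_var_ge /= le; rewrite -leqNgt leq_subLR.
by rewrite addn1 ltnS.
Qed.

(** The last-variable-free monomials among the [h] smallest stay independent modulo the lex segment
    and the multiples of [L]: eliminating the last variable fixes their span pointwise, kills the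
    multiples of [L] and preserves the lex segment, while the two sets of monomials are disjoint. *)
Lemma lex_section d h L : lincoef L ord_max != 0 ->
  (lastfree (M d.+1) h + \dim (mspan k d.+1 (drop h (lexinc r d.+1)) + limg (mulL d L))
   <= size (M d.+1))%N.
Proof.
move=> L0; rewrite lastfreeE; set s := [seq m <- _ | _]; set U := (_ + _)%VS.
have degs : {in s, forall a, mdeg a = d.+1}.
  by move=> a; rewrite mem_filter => /andP[_ /mem_take/deg_lexinc].
have degd : {in drop h (lexinc r d.+1), forall a, mdeg a = d.+1}.
  by move=> a /mem_drop/deg_lexinc.
have us : uniq s by rewrite filter_uniq // take_uniq // uniq_lexinc.
rewrite -(dim_mspan k us degs) -dimv_disjoint_sum; last first.
  apply/eqP; rewrite -subv0; apply/subvP => f.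
  case/memv_capP => fs /memv_addP[g gJ [_ /memv_imgP[q _ ->] fE]].
  have fJ : f \in mspan k d.+1 (drop h (lexinc r d.+1)).
    have ff : (f : R) = (g : R) \mPo elim_last L.
      rewrite -(@elim_last_id L f) => [|m mf]; last first.
        move: fs; rewrite mem_mspan // => /allP/(_ _ mf) /=.
        by rewrite mem_filter => /andP[/nchildren_last_free].
      by rewrite fE /= mulLE raddfD /= rmorphM /= elim_last_linform // mul0r addr0.
    rewrite mem_mspan //; apply/allP => m; rewrite ff [(g : R)]mpolyE linear_sum /=.
    move/msupp_sum_le/flattenP => [t /mapP[m1]]; rewrite filter_predT => m1g ->.
    rewrite linearZ /= => /msuppZ_le /supp_above_elim_last[dm lem].
    move: gJ; rewrite mem_mspan // => /allP/(_ _ m1g) /= m1d.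
    have dm1 : mdeg m = d.+1 by rewrite dm (degd _ m1d).
    exact: drop_lexinc_up dm1 m1d lem.
  rewrite memv0; apply/eqP/val_inj/eqP; rewrite /= -msupp_eq0.
  move: fs fJ; rewrite !mem_mspan //; case: (msupp _) => //= m t /andP[ms _] /andP[md _].
  move: ms; rewrite mem_filter => /andP[_ mt]; have := uniq_lexinc r d.+1.
  rewrite -(cat_take_drop h (lexinc _ _)) cat_uniq => /and3P[_ /hasPn/(_ _ md)].
  by rewrite /= mt.
by apply: leq_trans (dimvS (subvf _)) _; rewrite dim_lasts.
Qed.

End LexSection.

(** * Maximal rank and the lex-segment ideal *)

Section Ideals.
Variables (k : fieldType) (r : nat).
Local Notation R := {mpoly k[r.+1]}.
Local Notation R_ d := (dhomog r.+1 k d).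
Implicit Types (L : R_ 1) (p q : R) (I : {pred R}) (d i : nat).
Local Notation M := (lasts r.+1).

Lemma idealr_closedM I p q : idealr_closed I -> q \in I -> p * q \in I.
Proof. by case=> I0 _ Icl qI; rewrite -[_ * _]addr0 Icl. Qed.

Lemma idealr_closedN I p : idealr_closed I -> p \in I -> - p \in I.
Proof. by move=> Icl pI; rewrite -mulN1r idealr_closedM. Qed.

Lemma degpart_mulL I d L f : idealr_closed I ->
  f \in degpart I d -> mulL d L f \in degpart I d.+1.
Proof. by move=> Icl; rewrite !degpartP // mulLE; apply: idealr_closedM. Qed.

Lemma mul_injectiveP I L i : idealr_closed I ->
  mul_injective I L i <-> (mulL i L @^-1: degpart I i.+1 <= degpart I i)%VS.
Proof.
move=> Icl; split=> [inj|/subvP sub f g fg].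
  apply/subvP => f; rewrite -memv_preim !degpartP // mulLE => Lf.
  by have := inj f 0; rewrite /= !(mulr0, subr0); apply.
have := sub (f - g); rewrite -memv_preim !degpartP // mulLE; apply.
by rewrite mulrBr.
Qed.

Lemma mul_surjectiveP I L i : idealr_closed I ->
  mul_surjective I L i <-> (fullv <= degpart I i.+1 + limg (mulL i L))%VS.
Proof.
move=> Icl; split=> [surj|/subvP sub g].
  apply/subvP => g _; have [f fg] := surj g.
  rewrite -[g](subrK (mulL i L f)); apply: memv_add; last exact: memv_img (memvf _).
  by rewrite degpartP //= mulLE -opprB idealr_closedN.
have /memv_addP[h hI [_ /memv_imgP[f _ ->] ->]] := sub g (memvf _).
exists f; rewrite /= mulLE opprD addrC subrK; apply: idealr_closedN => //.
by rewrite -degpartP.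
Qed.

(** The cokernel has dimension at least [h_(i+1) - h_i], with equality exactly for an injective map,
    and is zero exactly for a surjective one. Truncated subtraction merges the two cases. *)
Lemma max_rankP I L i : idealr_closed I ->
  (mul_injective I L i \/ mul_surjective I L i) <->
  (size (M i.+1) <= \dim (degpart I i.+1 + limg (mulL i L))
     + (hilbert I i.+1 - hilbert I i))%N.
Proof.
move=> Icl; rewrite mul_injectiveP // mul_surjectiveP // /hilbert !dim_lasts.
have sI : (degpart I i <= mulL i L @^-1: degpart I i.+1)%VS.
  by apply/subvP => f fI; rewrite -memv_preim degpart_mulL.
have := dim_add_limg (mulL i L) (degpart I i.+1); have := dimvS sI.
have le0 := dimvS (subvf (degpart I i)).
have le1 := dimvS (subvf (degpart I i.+1)).
have le2 := dimvS (subvf (degpart I i.+1 + limg (mulL i L))).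
rewrite -(dimv_leqif_sup sI).
have -> : (fullv <= degpart I i.+1 + limg (mulL i L))%VS
   = (size (M i.+1) <= \dim (degpart I i.+1 + limg (mulL i L)))%N.
  rewrite -(dim_lasts k r i.+1); apply/idP/idP => [/dimvS //|le].
  by rewrite -(geq_leqif (dimv_leqif_sup (subvf _))).
move: le0 le1 le2; rewrite !dim_lasts.
set x0 := \dim (degpart I i); set x1 := \dim (degpart I i.+1).
set x2 := \dim (_ + _); set x3 := \dim (_ @^-1: _); clear.
lia.
Qed.

Lemma macaulay_hilbert I d : [pchar k] =i pred0 -> idealr_closed I ->
  (hilbert I d.+1 <= sumn (take (hilbert I d) (M d)))%N.
Proof.
move=> char0 Icl; rewrite /hilbert !dim_lasts; apply: macaulay => // L f.
exact: degpart_mulL.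
Qed.

Lemma hilbert_le I d : (hilbert I d <= size (lexinc r d))%N.
Proof. by rewrite /hilbert dim_dhomog leq_subr. Qed.

Lemma zariski_open_nonzero (p : R) : zariski_open (fun L : R_ 1 => p.@[lincoef L] != 0).
Proof.
by exists (eq p) => L; split=> [pL|[_ <-] //]; exists p.
Qed.

End Ideals.

(** * The lex-segment ideal with a given Hilbert function *)

Section LexIdeal.
Variables (k : fieldType) (r : nat) (hf : nat -> nat).
Local Notation R := {mpoly k[r.+1]}.
Local Notation R_ d := (dhomog r.+1 k d).
Local Notation M := (lasts r.+1).

(** The monomials left out in degree [d], the [hf d] smallest, are to form a basis of the
    quotient. *)
Definition in_lex (m : 'X_{1..r.+1}) : bool :=
  m \in drop (hf (mdeg m)) (lexinc r (mdeg m)).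

Definition lexideal : {pred R} := fun p => all in_lex (msupp p).

Lemma lexidealP p : reflect {in msupp p, forall m, in_lex m} (p \in lexideal).
Proof. exact: allP. Qed.

Hypothesis hf_gt0 : (0 < hf 0)%N.
Hypothesis hf_le : forall d, (hf d <= size (lexinc r d))%N.
Hypothesis hf_growth : forall d, (hf d.+1 <= sumn (take (hf d) (M d)))%N.

Lemma in_lexM m m' : in_lex m' -> in_lex (m + m')%MM.
Proof.
have step i a : in_lex a -> in_lex (a + U_(i))%MM.
  move=> La; rewrite /in_lex mdegD mdeg1 addn1; apply: drop_lexinc_mul La.
  exact: hf_growth.
move=> L'; rewrite [m]multinomUE_id addmC.
elim: (index_enum _) => [|i s IHs]; first by rewrite big_nil addm0.
rewrite big_cons addmA (addmC _ (_ *+ _)%MM) -addmA addmC.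
by elim: (m i) => [|n IHn]; rewrite ?mulm0n ?addm0 // mulmSr addmA; apply: step.
Qed.

Lemma lexideal_closed : idealr_closed lexideal.
Proof.
split.
- by apply/lexidealP => m; rewrite msupp0.
- apply/negP => /lexidealP/(_ 0%MM); rewrite msupp1 mem_head /in_lex mdeg0 => /(_ isT).
  by rewrite drop_oversize.
move=> a u v /lexidealP uJ /lexidealP vJ; apply/lexidealP => m /msuppD_le.
rewrite mem_cat => /orP[/msuppM_le|/vJ //].
by case/allpairsP => [[m1 m2] /= [_ /uJ m2J ->]]; apply: in_lexM.
Qed.

Lemma lexideal_homogeneous : homogeneous_ideal lexideal.
Proof.
split=> [|f d /lexidealP fJ]; first exact: lexideal_closed.
apply/lexidealP => m; rewrite pihomogE => /msupp_sum_le/flattenP[t /mapP[m1]].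
rewrite mem_filter => /andP[_ m1f] -> /msuppZ_le; rewrite msuppX inE => /eqP ->.
exact: fJ.
Qed.

Lemma degpart_lexideal d : degpart lexideal d = mspan k d (drop (hf d) (lexinc r d)).
Proof.
have degd : {in drop (hf d) (lexinc r d), forall a, mdeg a = d}.
  by move=> a /mem_drop/deg_lexinc.
apply/vspaceP => f; rewrite degpartP ?mem_mspan //; last exact: lexideal_closed.
apply: eq_in_all => m mf.
by rewrite /in_lex (dhomog_mf (dhomog_is_dhomog f) mf).
Qed.

Lemma dim_degpart_lexideal d :
  \dim (degpart lexideal d) = (size (lexinc r d) - hf d)%N.
Proof.
rewrite degpart_lexideal dim_mspan ?size_drop // ?drop_uniq ?uniq_lexinc //.
by move=> a /mem_drop/deg_lexinc.
Qed.

Lemma hilbert_lexideal d : hilbert lexideal d = hf d.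
Proof. by rewrite /hilbert dim_dhomog dim_degpart_lexideal subKn. Qed.

Lemma lexseg_lexideal d :
  lexseg k r d (\dim (degpart lexideal d)) = degpart lexideal d.
Proof.
rewrite dim_degpart_lexideal degpart_lexideal /lexseg take_lex_monomials //.
by rewrite map_rev; apply: eq_span => f; rewrite mem_rev.
Qed.

Lemma gotzmann_lexideal : gotzmann lexideal.
Proof. by move=> d; rewrite lexseg_lexideal. Qed.

Lemma lexideal_fin_dim e : (forall i, (e < i)%N -> hf i = 0%N) ->
  fin_dim_quotient lexideal.
Proof.
move=> hf0; pose s := [seq bmnm b | b : 'X_{1..r.+1 < e.+1}].
exists [seq 'X_[k, m] | m <- s] => f; exists (fun i => f@_(nth 0%MM s i)).
have us : uniq s by rewrite map_inj_uniq ?enum_uniq //; apply: val_inj.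
have -> : \sum_(i < size [seq 'X_[k, m] | m <- s])
   f@_(nth 0%MM s i) *: [seq 'X_[k, m] | m <- s]`_i = \sum_(m <- s) f@_m *: 'X_[m].
  rewrite -(big_mkord xpredT (fun i => f@_(nth 0%MM s i) *: [seq 'X_[k, m] | m <- s]`_i)).
  rewrite size_map [RHS](big_nth 0%MM); apply: eq_big_nat => i /andP[_ lti].
  by rewrite (nth_map 0%MM).
(* Subtracting the part of degree at most [e] leaves monomials of higher degree, all in the ideal
   since [hf] vanishes there. *)
apply/lexidealP => m mf.
have [le|lt] := leqP (mdeg m) e; last first.
  by rewrite /in_lex hf0 // drop0 mem_lexinc.
have ms : m \in s.
  by apply/mapP; exists (BMultinom (le : (mdeg m < e.+1)%N)); rewrite ?mem_enum.
move: mf; rewrite mcoeff_msupp mcoeffB raddf_sum /= (bigD1_seq m) //= mcoeffZ mcoeffX eqxx.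
rewrite mulr1 big1 ?addr0 ?subrr ?eqxx // => m' ne.
by rewrite mcoeffZ mcoeffX (negbTE ne) mulr0.
Qed.

End LexIdeal.

(** * The Weak Lefschetz Property as a numerical condition *)

Section WLP.
Variables (k : fieldType) (r : nat).
Local Notation R := {mpoly k[r.+1]}.
Local Notation R_ d := (dhomog r.+1 k d).
Implicit Types (L : R_ 1) (I : {pred R}).
Local Notation M := (lasts r.+1).
Hypothesis char0 : [pchar k] =i pred0.

Lemma generic_zariski_open (U : R_ 1 -> Prop) :
  zariski_open U -> (exists L, U L) -> generic U.
Proof.
case=> S SU [L /SU[p Sp pL]]; exists p => [|L' pL'].
  by apply: contraNneq pL => ->; rewrite meval0.
by apply/SU; exists p.
Qed.

Lemma generic_lincoef i : generic (fun L => lincoef L i != 0).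
Proof.
exists 'X_i => [|L]; last by rewrite mevalXU.
apply/eqP => /(congr1 (mcoeff U_(i))); rewrite mcoeffX eqxx mcoeff0 => /eqP.
by rewrite oner_eq0.
Qed.

(** For a form [L] of maximal rank that involves the last variable, the cokernel is bounded above by
    the truncated difference and below, through [lex_section], by [lastfree]. *)
Lemma WLP_lexideal_lastfree hf i :
  (0 < hf 0)%N -> (forall d, hf d <= size (lexinc r d))%N ->
  (forall d, hf d.+1 <= sumn (take (hf d) (M d)))%N -> WLP (lexideal hf : {pred R}) ->
  (lastfree (M i.+1) (hf i.+1) <= hf i.+1 - hf i)%N.
Proof.
move=> hf0 hfle hfgr [U [Uopen Uex UL]].
have [L [/UL/(_ i) Lmax L0]] := generic_exists char0
  (generic_and (generic_zariski_open Uopen Uex) (generic_lincoef ord_max)).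
have := lex_section i (hf i.+1) L0; move: Lmax.
rewrite max_rankP; last exact: lexideal_closed.
rewrite !hilbert_lexideal // degpart_lexideal //.
by move=> le1 le2; have := leq_trans le2 le1; rewrite addnC leq_add2l.
Qed.

Lemma lastfree_WLP I e : idealr_closed I ->
  (forall i, (e < i)%N -> hilbert I i = 0%N) ->
  (forall i, lastfree (M i.+1) (hilbert I i.+1) <= hilbert I i.+1 - hilbert I i)%N ->
  WLP I.
Proof.
move=> Icl Ie Ifree; pose mr i L := mul_injective I L i \/ mul_surjective I L i.
have mr_gen i : generic (mr i).
  have [L Lg] := green char0 (degpart I i.+1).
  apply: generic_sub (generic_dim (degpart I i.+1) L) => L' leL; apply/max_rankP => //.
  apply: leq_trans Lg (leq_add leL _); have := Ifree i.
  by rewrite {1}/hilbert dim_lasts.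
(* Only [i < e] needs a generic [L]: from [i = e] on the target of the map is zero. *)
have [p p0 pP] := generic_all e mr_gen.
exists (fun L => p.@[lincoef L] != 0); split=> [||L pL i].
- exact: zariski_open_nonzero.
- by apply: (generic_exists char0); exists p.
have [/(pP L pL i) //|lei] := ltnP i e; apply/max_rankP => //.
rewrite Ie // sub0n addn0; have /eqP := Ie i.+1 lei; rewrite subn_eq0 dim_lasts => le.
by rewrite (leq_trans le) // dimvS // addvSl.
Qed.

End WLP.

Local Close Scope ring_scope.

Theorem corollary6 (k : fieldType) (char0 : [pchar k]%R =i pred0)
    (e : nat) (H : nat -> nat)
    (H0 : H 0 = 1) (He : forall i, e < i -> H i = 0)
    (Hoccurs : exists (r : nat) (I : {pred {mpoly k[r.+1]}}),
       artinian_ideal I /\ (forall i, hilbert I i = H i)) :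
  (forall (r : nat) (I : {pred {mpoly k[r.+1]}}),
     artinian_ideal I -> (forall i, hilbert I i = H i) -> WLP I)
  <->
  (forall (r : nat) (I : {pred {mpoly k[r.+1]}}),
     artinian_ideal I -> gotzmann I -> (forall i, hilbert I i = H i) -> WLP I).
Proof.
split=> [allWLP r I artI _ | gotzWLP r I [[Icl _] _] IH]; first exact: allWLP.
have hf0 : (0 < H 0)%N by rewrite H0.
have hfle d : (H d <= size (lexinc r d))%N by rewrite -IH hilbert_le.
have hfgr d : (H d.+1 <= sumn (take (H d) (lasts r.+1 d)))%N.
  by rewrite -!IH macaulay_hilbert.
(* The lex-segment ideal is taken in the polynomial ring of [I]; the WLP of its quotient supplies
   the numerical condition for [I]. *)
apply: (lastfree_WLP char0 (e := e)) => // [i ei|i]; first by rewrite IH He.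
rewrite !IH; apply: WLP_lexideal_lastfree => //; apply: gotzWLP.
- by split; [exact: lexideal_homogeneous | exact: lexideal_fin_dim He].
- exact: gotzmann_lexideal.
- by move=> d; rewrite hilbert_lexideal.
Qed.
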